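(* Let $n \ge 3$ and let $J_n$ be the cactus group. Then all the dihedral groups $D_m$, $m \ge 1$, and the infinite dihedral group $\mathbb{Z}_2 * \mathbb{Z}_2$ are non-trivial quotients of $J_n$. In particular, the dihedral group $D_4$ (of order $8$) is the smallest non-Abelian quotient of $J_n$ after $S_3$, i.e. $D_4$ is a quotient of $J_n$, and every non-Abelian quotient of $J_n$ not isomorphic to $S_3$ has order at least $8$. Further, there is no upper bound on the order of the finite quotients of $J_n$.
   Context: For integers $p<q$ write $[p,q]=\{p,p+1,\dots,q\}$. For $n\ge 2$ the cactus group $J_n$ is the group generated by $\{\sigma_{p,q} \mid 1\le p<q\le n\}$ with defining relations (1) $\sigma_{p,q}^2=1$ for $1\le p<q\le n$; (2) $\sigma_{p,q}\sigma_{r,s}=\sigma_{r,s}\sigma_{p,q}$ whenever $[p,q]\cap[r,s]=\emptyset$; (3) $\sigma_{p,q}\sigma_{r,s}=\sigma_{p+q-s,\,p+q-r}\,\sigma_{p,q}$ whenever $[r,s]\subset[p,q]$. The dihedral group $D_m$ is the group of order $2m$ with presentation $\langle a,b \mid a^2=b^2=(ab)^m=1\rangle$. The infinite dihedral group is $\mathbb{Z}_2*\mathbb{Z}_2=\langle a,b\mid a^2=b^2=1\rangle$. $S_3$ is the symmetric group on three letters. A quotient of a group $G$ is a group $Q$ for which there is a surjective homomorphism $G\to Q$. *)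

(* Defs.v *)
From HB Require Import structures.
From mathcomp Require Import all_boot fingroup perm.
From mathcomp Require Import boolp classical_sets functions cardinality.

Set Implicit Arguments.
Unset Strict Implicit.
Unset Printing Implicit Defensive.

Local Open Scope group_scope.
Local Open Scope quotient_scope.

(* A letter [inl x] stands for the generator x, [inr x] for its inverse. *)
Definition word (X : choiceType) : choiceType := seq (X + X).

Definition inv_letter (X : choiceType) (l : X + X) : X + X :=
  match l with inl x => inr x | inr x => inl x end.

(* [R u v] is read as the defining relation u = v of the presentation; words
   are identified up to the least monoid congruence that contains [R] and
   the cancellation of letters. *)
Inductive word_eq (X : choiceType) (R : word X -> word X -> Prop) :
    word X -> word X -> Prop :=
| WordRefl u : word_eq R u u
| WordSym u v : word_eq R u v -> word_eq R v u
| WordTrans u v w : word_eq R u v -> word_eq R v w -> word_eq R u w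
| WordCat u u' v v' : word_eq R u u' -> word_eq R v v' ->
    word_eq R (u ++ v) (u' ++ v')
| WordCancel l : word_eq R [:: l; inv_letter l] [::]
| WordRel u v : R u v -> word_eq R u v.

Local Notation repr := generic_quotient.repr.

Section Presentation.
Variables (X : choiceType) (R : word X -> word X -> Prop).

Definition word_eqb (u v : word X) : bool := `[< word_eq R u v >].

Lemma word_eqb_refl : reflexive word_eqb.
Proof. by move=> u; apply/asboolP/WordRefl. Qed.

Lemma word_eqb_sym : symmetric word_eqb.
Proof. by move=> u v; apply/asboolP/asboolP; apply: WordSym. Qed.

Lemma word_eqb_trans : transitive word_eqb.
Proof.
by move=> v u w /asboolP uv /asboolP vw; apply/asboolP/(WordTrans uv vw).
Qed.

Canonical word_equiv :=
  EquivRel word_eqb word_eqb_refl word_eqb_sym word_eqb_trans.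

Definition presented : Type := {eq_quot word_equiv}.

HB.instance Definition _ := Choice.on presented.
HB.instance Definition _ := EqQuotient.on presented.

Definition pres_mul (x y : presented) : presented :=
  \pi_presented (repr x ++ repr y).
Definition pres_one : presented := \pi_presented [::].
Definition pres_inv (x : presented) : presented :=
  \pi_presented (rev (map (@inv_letter X) (repr x))).

Lemma presP (u v : word X) :
  word_eq R u v <-> \pi_presented u = \pi_presented v.
Proof.
by split=> [uv|/eqquotP/asboolP//]; apply/eqquotP/asboolP.
Qed.

Lemma word_eq_repr (u : word X) : word_eq R (repr (\pi_presented u)) u.
Proof. by apply/presP; rewrite reprK. Qed.

Lemma pres_mulE (u v : word X) :
  pres_mul (\pi_presented u) (\pi_presented v) = \pi_presented (u ++ v).
Proof. by apply/presP; apply: WordCat; apply: word_eq_repr. Qed.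

Lemma pres_mulA : associative pres_mul.
Proof.
elim/quotW=> u; elim/quotW=> v; elim/quotW=> w.
rewrite (pres_mulE u v) (pres_mulE v w) (pres_mulE u).
by rewrite (pres_mulE (u ++ v)) catA.
Qed.

Lemma pres_mul1 : left_id pres_one pres_mul.
Proof. by elim/quotW=> u; rewrite pres_mulE. Qed.

Lemma pres_mulr1 : right_id pres_one pres_mul.
Proof. by elim/quotW=> u; rewrite pres_mulE cats0. Qed.

Lemma inv_letterK : involutive (@inv_letter X).
Proof. by case. Qed.

Lemma word_eq_invr (u : word X) :
  word_eq R (u ++ rev (map (@inv_letter X) u)) [::].
Proof.
elim: u => [|l u IH] /=; first exact: WordRefl.
rewrite rev_cons -cats1 catA -cat1s.
apply: WordTrans (WordCancel R l); rewrite -[[:: l; _]]cat1s.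
apply: WordCat; first exact: WordRefl.
rewrite -[[:: inv_letter l] in X in word_eq _ _ X]cat0s.
exact: WordCat IH (WordRefl _ _).
Qed.

Lemma pres_mulV : right_inverse pres_one pres_inv pres_mul.
Proof.
move=> x; rewrite -[x in pres_mul x]reprK pres_mulE.
exact/presP/word_eq_invr.
Qed.

Lemma pres_mulVl : left_inverse pres_one pres_inv pres_mul.
Proof.
move=> x; rewrite -[x in pres_mul _ x]reprK pres_mulE; apply/presP.
have := word_eq_invr (rev (map (@inv_letter X) (repr x))).
by rewrite map_rev revK (mapK inv_letterK).
Qed.

HB.instance Definition _ := isGroup.Build presented
  pres_mulA pres_mul1 pres_mulr1 pres_mulVl pres_mulV.

End Presentation.

Definition gen (X : choiceType) (x : X) : X + X := inl x.

(* The generator sigma_{p,q} is indexed by the pair (p, q). *)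
Definition cactus_gen (n : nat) : choiceType :=
  {pq : nat * nat | (1 <= pq.1) && (pq.1 < pq.2 <= n)}%N.

Definition nat_itv (pq : nat * nat) : pred nat :=
  [pred k | pq.1 <= k <= pq.2]%N.

(* In [CactusFlip] the generator z is sigma_{p+q-s,p+q-r}; since [r,s] is
   contained in [p,q], it exists and the subtractions are not truncated. *)
Inductive cactus_rel (n : nat) :
    word (cactus_gen n) -> word (cactus_gen n) -> Prop :=
| CactusInvol (x : cactus_gen n) : cactus_rel [:: gen x; gen x] [::]
| CactusComm (x y : cactus_gen n) :
    (forall k : nat, ~ (k \in nat_itv (val x) /\ k \in nat_itv (val y))) ->
    cactus_rel [:: gen x; gen y] [:: gen y; gen x]
| CactusFlip (x y z : cactus_gen n) :
    {subset nat_itv (val y) <= nat_itv (val x)} ->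
    val z = ((val x).1 + (val x).2 - (val y).2,
             (val x).1 + (val x).2 - (val y).1)%N ->
    cactus_rel [:: gen x; gen y] [:: gen z; gen x].

Definition cactus (n : nat) : groupType := presented (@cactus_rel n).

(* The two generators a and b are indexed by [false] and [true]. *)
Definition dih_a : bool + bool := gen false.
Definition dih_b : bool + bool := gen true.

Inductive infinite_dihedral_rel : word bool -> word bool -> Prop :=
| InfDihA : infinite_dihedral_rel [:: dih_a; dih_a] [::]
| InfDihB : infinite_dihedral_rel [:: dih_b; dih_b] [::].

Definition infinite_dihedral : groupType := presented infinite_dihedral_rel.

Inductive dihedral_rel (m : nat) : word bool -> word bool -> Prop :=
| DihA : dihedral_rel m [:: dih_a; dih_a] [::]
| DihB : dihedral_rel m [:: dih_b; dih_b] [::]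
| DihAB : dihedral_rel m (flatten (nseq m [:: dih_a; dih_b])) [::].

Definition dihedral (m : nat) : groupType := presented (dihedral_rel m).

Definition is_quotient (G Q : groupType) : Prop :=
  exists f : {multiplicative G -> Q}, forall y : Q, exists x : G, f x = y.

Definition group_iso (G H : groupType) : Prop :=
  exists f : {multiplicative G -> H}, bijective f.

Definition nontrivial_group (G : groupType) : Prop := exists x : G, x <> 1.

Definition abelian_group (G : groupType) : Prop :=
  forall x y : G, commute x y.

(* Main.v *)
Require Import Defs.
From HB Require Import structures.
From mathcomp Require Import all_boot fingroup perm.
From mathcomp Require Import ssralg zmodp zify.
From mathcomp Require Import boolp classical_sets functions cardinality.

Set Implicit Arguments.
Unset Strict Implicit.
Unset Printing Implicit Defensive.

(** Why the theorem holds.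

    The relations of J_n preserve the length q - p of an interval [p,q], and
    two intervals of length at least n - 2 always meet when n >= 3. So for
    any two involutions a and b of a group G there is a homomorphism from J_n
    to G with
      s_{1,n} |-> b,  s_{1,n-1} |-> a,  s_{2,n} |-> b a b,
    and trivial on the generators of shorter intervals: besides s^2 = 1,
    all that remains to respect is that conjugation by s_{1,n} exchanges
    s_{1,n-1} and s_{2,n} ([cactus_to_involutions]). Hence every group
    generated by two involutions is a quotient of J_n, in particular Z_2 * Z_2
    and all D_m.

    The quantitative statements rest on the normal form (a b)^k a^e of the
    elements of such a group. If (a b)^m = 1 these elements, with k < m and
    e = 0 or 1, exhaust the subgroup generated by a and b
    ([dih_normal_form_gen]). If a and b do not commute and (a b)^k <> 1 for
    0 < k < m, they are pairwise distinct ([dih_elt_inj]). Comparing the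
    two facts gives [dihedral_hom_inj] and [dihedral_finite_iso], which
    identify D_3 with S_3 and D_m, for m >= 3, with an explicit finite group
    of order 2 m. This yields the order of D_4 and finite quotients of
    arbitrarily large order.

    For the minimality of D_4, a non-abelian quotient Q of J_n contains two
    non-commuting involutions a and b, because J_n is generated by
    involutions. If (a b)^3 <> 1, the normal forms with k < 4 give 8 elements
    of Q. If (a b)^3 = 1, then D_3 embeds into Q, and either the embedding is
    onto and Q is S_3, or a second coset of its image brings the number of
    elements to at least 12 ([noncommuting_involutions_card]). This argument
    also covers infinite Q. *)

(** * The universal property of a presentation *)

Section DihedralQuotients.
Local Open Scope group_scope.
Local Open Scope quotient_scope.

Definition letter_val (X : choiceType) (G : groupType) (phi : X -> G)
    (l : X + X) : G :=
  match l with inl x => phi x | inr x => (phi x)^-1 end.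

Definition word_val (X : choiceType) (G : groupType) (phi : X -> G)
    (w : word X) : G :=
  \prod_(l <- w) letter_val phi l.

Definition pres_gen (X : choiceType) (R : word X -> word X -> Prop) (x : X) :
    presented R := \pi_(presented R) [:: gen x].

Section UniversalProperty.
Variables (X : choiceType) (R : word X -> word X -> Prop).

Lemma word_val_eq (G : groupType) (phi : X -> G) (u v : word X) :
  (forall u v, R u v -> word_val phi u = word_val phi v) ->
  word_eq R u v -> word_val phi u = word_val phi v.
Proof.
move=> phiR; elim=> {u v} // [u v w _ -> _ -> //|u u' v v' _ IHu _ IHv|l].
  by rewrite /word_val !big_cat -!/(word_val _ _) IHu IHv.
by rewrite /word_val big_cons big_seq1 big_nil; case: l => x /=;
  rewrite ?mulgV ?mulVg.
Qed.

Lemma pi_cat (u v : word X) :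
  \pi_(presented R) (u ++ v) = \pi_(presented R) u * \pi_(presented R) v.
Proof. exact/esym/pres_mulE. Qed.

(** This is von Dyck's theorem. *)
Lemma presented_lift (G : groupType) (phi : X -> G) :
  (forall u v, R u v -> word_val phi u = word_val phi v) ->
  exists f : {multiplicative presented R -> G},
    forall x, f (pres_gen R x) = phi x.
Proof.
move=> phiR; pose f (x : presented R) := word_val phi (generic_quotient.repr x).
have fE u : f (\pi_(presented R) u) = word_val phi u.
  by apply: word_val_eq phiR _; apply: word_eq_repr.
have fM : {morph f : x y / x * y}.
  elim/quotW=> u; elim/quotW=> v; rewrite -pi_cat !fE.
  by rewrite /word_val big_cat.
exists (HB.pack_for {multiplicative presented R -> G} f
  (isMultiplicative.Build _ _ f fM)) => x.
by rewrite [LHS]fE /word_val big_seq1.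
Qed.

(** Every element is reached from 1 by left multiplication by generators and
    their inverses, since a word can be built up letter by letter. *)
Lemma presented_ind (P : presented R -> Prop) :
  P 1 -> (forall x y, P y -> P (pres_gen R x * y)) ->
  (forall x y, P y -> P ((pres_gen R x)^-1 * y)) -> forall x, P x.
Proof.
move=> P1 PM PV; elim/quotW; elim=> [//|[x|x] w Pw].
  by rewrite -cat1s pi_cat; apply: PM.
rewrite -cat1s pi_cat.
suff -> : \pi_(presented R) [:: inr x] = (pres_gen R x)^-1 by exact: PV.
apply/esym/mulg1_eq; rewrite /pres_gen -pi_cat.
exact/presP/(WordCancel R (gen x)).
Qed.

End UniversalProperty.

(** * Homomorphisms and quotients *)

Lemma hom_one (G H : groupType) (f : {multiplicative G -> H}) : f 1 = 1.
Proof. by apply: (mulgI (f 1)); rewrite -gmulfM !mulg1. Qed.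

Lemma hom_inv (G H : groupType) (f : {multiplicative G -> H}) :
  {morph f : x / x^-1}.
Proof. by move=> x; apply/esym/mulg1_eq; rewrite -gmulfM mulgV hom_one. Qed.

Lemma hom_exp (G H : groupType) (f : {multiplicative G -> H}) k :
  {morph f : x / x ^+ k}.
Proof.
by move=> x; elim: k => [|k IH]; rewrite ?hom_one // !expgS gmulfM IH.
Qed.

Lemma is_quotient_trans (G H K : groupType) :
  is_quotient G H -> is_quotient H K -> is_quotient G K.
Proof.
move=> [f fs] [g gs]; exists (g \o f) => z.
by have [y <-] := gs z; have [x <-] := fs y; exists x.
Qed.

Lemma group_iso_sym (G H : groupType) : group_iso G H -> group_iso H G.
Proof.
move=> [f [g fK gK]].
exists (HB.pack_for {multiplicative H -> G} g
  (isMultiplicative.Build _ _ g (can2_gmulfM fK gK))).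
by exists f.
Qed.

Lemma group_iso_trans (G H K : groupType) :
  group_iso G H -> group_iso H K -> group_iso G K.
Proof. by move=> [f fb] [g gb]; exists (g \o f); apply: bij_comp. Qed.

Lemma group_iso_quotient (G H : groupType) : group_iso G H -> is_quotient G H.
Proof. by move=> [f [g _ gK]]; exists f => y; exists (g y). Qed.

Lemma hom_onto_presented (G : groupType) (X : choiceType)
    (R : word X -> word X -> Prop) (f : {multiplicative G -> presented R}) :
  (forall x, exists g, f g = pres_gen R x) -> is_quotient G (presented R).
Proof.
move=> fgen; exists f; elim/presented_ind => [|x y|x y].
- by exists 1; rewrite hom_one.
- by move=> [g <-]; have [h <-] := fgen x; exists (h * g); rewrite gmulfM.
- move=> [g <-]; have [h <-] := fgen x; exists (h^-1 * g).
  by rewrite gmulfM hom_inv.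
Qed.

(** * Groups generated by two involutions *)

Section Involutions.
Variables (G : groupType) (a b : G).
Hypotheses (aa : a * a = 1) (bb : b * b = 1).

Definition bool_pair (t : bool) : G := if t then b else a.

Lemma infinite_dihedral_lift :
  exists f : {multiplicative infinite_dihedral -> G},
    forall t, f (pres_gen infinite_dihedral_rel t) = bool_pair t.
Proof.
by apply: presented_lift => _ _ [];
  rewrite /word_val !(big_cons, big_nil) /= mulg1.
Qed.

Lemma dihedral_lift (m : nat) : (a * b) ^+ m = 1 ->
  exists f : {multiplicative dihedral m -> G},
    forall t, f (pres_gen (dihedral_rel m) t) = bool_pair t.
Proof.
move=> abm; apply: presented_lift => _ _ [];
  rewrite /word_val ?(big_cons, big_nil) /= ?mulg1 //.
rewrite -[RHS]abm; elim: m {abm} => [|m IH]; first by rewrite big_nil.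
by rewrite /= !big_cons IH expgS mulgA.
Qed.

Definition dih_elt (m : nat) (p : 'I_m * bool) : G := (a * b) ^+ p.1 * a ^+ p.2.

(** Conjugation by a sends a b to b a, which is the inverse of a b. *)
Lemma rotation_flip k : a * (a * b) ^+ k = (a * b) ^- k * a.
Proof.
have aV : a^-1 = a by apply: mulg1_eq.
have bV : b^-1 = b by apply: mulg1_eq.
have abV : (a * b)^-1 = b * a by rewrite invgM aV bV.
rewrite -expVgn abV; elim: k => [|k IH]; first by rewrite mulg1 mul1g.
by rewrite expgSr mulgA IH expgSr !mulgA -!(mulgA _ a a) aa !mulg1.
Qed.

Definition dih_normal_form (m : nat) (g : G) :=
  exists p : 'I_m * bool, dih_elt p = g.

(** Normal forms are closed under left multiplication by a, which inverts the
    rotation, and by a b, which shifts the exponent; hence also by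
    b = a (a b). Together with 1 they therefore exhaust the subgroup that a
    and b generate. *)
Lemma dih_normal_form_gen (m : nat) : 0 < m -> (a * b) ^+ m = 1 ->
  [/\ dih_normal_form m 1,
      forall g, dih_normal_form m g -> dih_normal_form m (a * g) &
      forall g, dih_normal_form m g -> dih_normal_form m (b * g)].
Proof.
move=> m0 abm.
have nfX k (e : bool) : dih_normal_form m ((a * b) ^+ k * a ^+ e).
  rewrite (divn_eq k m) expgnDr mulnC expgnA abm expg1n mul1g.
  by exists (Ordinal (ltn_pmod k m0), e).
have nfa g : dih_normal_form m g -> dih_normal_form m (a * g).
  move=> [[k e] <-]; rewrite /dih_elt mulgA rotation_flip -mulgA /=.
  have -> : a * a ^+ e = a ^+ ~~ e by case: e => /=; rewrite ?expg1 ?mulg1.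
  (* k * m.-1 is congruent to - k modulo m. *)
  suff -> : (a * b) ^- k = (a * b) ^+ (k * m.-1) by apply: nfX.
  apply: mulg1_eq; rewrite -expgnDr -mulnS prednK // mulnC expgnA abm.
  exact: expg1n.
split=> // [|g [[k e] <-]]; first by have := nfX 0 false; rewrite /= mulg1.
have -> h : b * h = a * (a * b * h) by rewrite !mulgA aa mul1g.
by apply: nfa; rewrite /dih_elt mulgA -expgS.
Qed.

(** Two equal normal forms with the same exponent of a give a trivial
    power of a b, excluded by the bound on k; with different exponents they
    make a a power of a b, so that a commutes with a b and with b. *)
Lemma dih_elt_inj (m : nat) : ~ commute a b ->
  (forall k, 0 < k < m -> (a * b) ^+ k <> 1) -> injective (@dih_elt m).
Proof.
move=> ncab rk.
have aNr k l : (a * b) ^+ k * a <> (a * b) ^+ l.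
  move=> e; have {}e : a = (a * b) ^- k * (a * b) ^+ l by rewrite -e mulKg.
  apply: ncab; have : commute (a * b) a.
    rewrite [in X in commute _ X]e; apply: commuteM; last exact: commuteX.
    exact/commuteV/commuteX.
  by rewrite /commute -mulgA => /mulgI /esym.
have rkinj k l : k <= l < m -> (a * b) ^+ k = (a * b) ^+ l -> k = l.
  move=> /andP[kl lm] e; apply/eqP; rewrite eqn_leq kl /= leqNgt.
  apply/negP => lk.
  apply: (rk (l - k)); first by rewrite subn_gt0 lk; lia.
  by rewrite expgnFr // e mulgV.
move=> [[k km] [] ] [[l lm] []]; rewrite /dih_elt /= ?expg1 ?mulg1.
- move/mulIg => e; congr (_, _); apply: val_inj => /=.
  by case/orP: (leq_total k l) => h; [|apply/esym]; apply: rkinj; rewrite ?h.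
- by move/aNr.
- by move/esym/aNr.
- move=> e; congr (_, _); apply: val_inj => /=.
  by case/orP: (leq_total k l) => h; [|apply/esym]; apply: rkinj; rewrite ?h.
Qed.

End Involutions.

(** * The dihedral groups *)

Local Notation dgen m := (pres_gen (dihedral_rel m)).

Lemma dihedral_gen_sq m t : dgen m t * dgen m t = 1.
Proof.
by rewrite /pres_gen -pi_cat; apply/presP/WordRel; case: t; constructor.
Qed.

Lemma dihedral_gen_prod_exp m : (dgen m false * dgen m true) ^+ m = 1.
Proof.
suff -> k : (dgen m false * dgen m true) ^+ k =
    \pi_(presented (dihedral_rel m)) (flatten (nseq k [:: dih_a; dih_b])).
  exact/presP/WordRel/DihAB.
by elim: k => [//|k IH]; rewrite expgS IH /pres_gen -!pi_cat.
Qed.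

Lemma dihedral_normal_form m (x : dihedral m) : 0 < m ->
  dih_normal_form (dgen m false) (dgen m true) m x.
Proof.
move=> m0; have sq := dihedral_gen_sq m.
have [nf1 nfa nfb] :=
  dih_normal_form_gen (sq false) (sq true) m0 (dihedral_gen_prod_exp m).
have gV t : (dgen m t)^-1 = dgen m t by apply: mulg1_eq.
by elim/presented_ind: x => [//|[] y|[] y] nfy; rewrite ?gV;
  [apply: nfb|apply: nfa|apply: nfb|apply: nfa].
Qed.

(** The images of the normal forms are the normal forms of the images of the
    generators, which are distinct. *)
Lemma dihedral_hom_inj (G : groupType) (m : nat)
    (f : {multiplicative dihedral m -> G}) :
  0 < m -> ~ commute (f (dgen m false)) (f (dgen m true)) ->
  (forall k, 0 < k < m ->
     (f (dgen m false) * f (dgen m true)) ^+ k <> 1) ->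
  injective f.
Proof.
move=> m0 ncab rk x y.
have fsq t : f (dgen m t) * f (dgen m t) = 1.
  by rewrite -gmulfM dihedral_gen_sq hom_one.
have [p <-] := dihedral_normal_form x m0.
have [q <-] := dihedral_normal_form y m0.
rewrite /dih_elt !gmulfM !hom_exp !gmulfM => e; congr (dih_elt _ _ _).
exact: (dih_elt_inj ncab rk).
Qed.

(** For involutions, a b = 1 means a = b, and (a b)^2 = 1 means that a and b
    commute. *)
Lemma noncommuting_sq_neq1 (G : groupType) (a b : G) :
  a * a = 1 -> b * b = 1 -> ~ commute a b ->
  forall k, 0 < k < 3 -> (a * b) ^+ k <> 1.
Proof.
move=> aa bb ncab [|[|[|//]]] // _; rewrite ?expg1 ?expg2 => e; apply: ncab.
  by rewrite /commute e -(mulg1_eq e) mulVg.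
by have := mulg1_eq e; rewrite invgM (mulg1_eq aa) (mulg1_eq bb).
Qed.

(** By counting, the 2 m distinct normal forms fill G. *)
Lemma dihedral_finite_iso (G : finGroupType) (m : nat) (a b : G) :
  0 < m -> a * a = 1 -> b * b = 1 -> (a * b) ^+ m = 1 -> ~ commute a b ->
  (forall k, 0 < k < m -> (a * b) ^+ k <> 1) -> #|{: G}| = (2 * m)%N ->
  group_iso (dihedral m) G.
Proof.
move=> m0 aa bb abm ncab rk cardG.
have [f fE] := dihedral_lift aa bb abm.
exists f; have finj : injective f by apply: dihedral_hom_inj; rewrite ?fE.
have cardE : #|{: 'I_m * bool}| = #|{: G}|.
  by rewrite card_prod card_ord card_bool cardG mulnC.
have einj := dih_elt_inj ncab rk.
rewrite -setTT_bijective; split=> // [x y _ _ /finj //|y _].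
have := inj_card_onto einj (eq_leq (esym cardE)) y.
move=> /codomP[p ->]; exists (dih_elt (dgen m false) (dgen m true) p) => //.
by rewrite /dih_elt !gmulfM !hom_exp !gmulfM !fE.
Qed.

(** The semidirect product of Z/m by the group of order 2 acting by negation:
    (i, e) stands for the symmetry x |-> i + (-1)^e x of Z/m, m >= 2. It
    gives a lower bound on the order of the presented group. *)
Definition zdih (m : nat) : Type := ('Z_m * bool)%type.

HB.instance Definition _ m := Finite.on (zdih m).

Section DihedralModel.
Variable m : nat.
Import GRing.Theory.

Definition zdih_mul (x y : zdih m) : zdih m :=
  ((x.1 + (if x.2 then - y.1 else y.1))%R, x.2 (+) y.2).
Definition zdih_one : zdih m := (0%R, false).
Definition zdih_inv (x : zdih m) : zdih m :=
  ((if x.2 then x.1 else - x.1)%R, x.2).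

Lemma zdih_mulA : associative zdih_mul.
Proof.
move=> [i s] [j t] [k u]; rewrite /zdih_mul /= addbA; congr (_, _).
by case: s t => [] [] /=; rewrite ?opprD ?opprK addrA.
Qed.

Lemma zdih_mul1 : left_id zdih_one zdih_mul.
Proof. by move=> [i s]; rewrite /zdih_mul /= add0r. Qed.

Lemma zdih_mulV : left_inverse zdih_one zdih_inv zdih_mul.
Proof.
by move=> [i []]; rewrite /zdih_mul /zdih_one /= ?subrr ?addNr.
Qed.

HB.instance Definition _ :=
  Finite_isGroup.Build (zdih m) zdih_mulA zdih_mul1 zdih_mulV.

Definition zdih_refl (i : 'Z_m) : zdih m := (i, true).

Lemma zdih_refl_sq i : zdih_refl i * zdih_refl i = 1.
Proof. by rewrite [LHS]/mul /= /zdih_mul /= subrr. Qed.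

Lemma zdih_rotation_exp k :
  (zdih_refl 1%R * zdih_refl 0%R) ^+ k = ((k%:R)%R, false).
Proof.
elim: k => [//|k IH]; rewrite expgS IH [LHS]/mul /= /zdih_mul /=.
by rewrite oppr0 addr0 mulrS.
Qed.

Lemma card_zdih : 1 < m -> #|{: zdih m}| = (2 * m)%N.
Proof. by move=> m1; rewrite card_prod card_bool card_ord Zp_cast // mulnC. Qed.

End DihedralModel.

Lemma zdih_rotation_exp_eq1 m k : 1 < m ->
  ((zdih_refl 1%R * zdih_refl 0%R) ^+ k == 1 :> zdih m) = (m %| k).
Proof.
move=> m1; rewrite zdih_rotation_exp -[m %| k]/(k %% m == 0) -val_Zp_nat //.
by apply/eqP/eqP => [[->]//|k0]; congr (_, _); apply: val_inj.
Qed.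

Lemma zdih_refl_not_commute m : 2 < m ->
  ~ commute (zdih_refl 1%R : zdih m) (zdih_refl 0%R).
Proof.
move=> m3 cab; suff : m %| 2 by move/dvdn_leq => /(_ isT); rewrite leqNgt m3.
rewrite -zdih_rotation_exp_eq1 ?(ltnW m3) // expgMn // !expg2 !zdih_refl_sq.
exact/eqP/mulg1.
Qed.

Lemma dihedral_zdih_iso (m : nat) : 2 < m -> group_iso (dihedral m) (zdih m).
Proof.
move=> m3; have m1 := ltnW m3.
apply: (dihedral_finite_iso (a := zdih_refl 1%R) (b := zdih_refl 0%R)).
- exact: ltnW m1.
- exact: zdih_refl_sq.
- exact: zdih_refl_sq.
- by apply/eqP; rewrite zdih_rotation_exp_eq1.
- exact: zdih_refl_not_commute.
- move=> k /andP[k0 km] /eqP; rewrite zdih_rotation_exp_eq1 //.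
  by move=> /(dvdn_leq k0); rewrite leqNgt km.
- by rewrite card_zdih.
Qed.

(** The transpositions (0 1) and (1 2) do not commute and satisfy the braid
    relation, so their product has order 3. *)
Lemma dihedral3_S3_iso : group_iso (dihedral 3) {perm 'I_3}.
Proof.
pose i0 : 'I_3 := ord0; pose i1 : 'I_3 := Ordinal (isT : 1 < 3).
pose i2 : 'I_3 := ord_max.
pose a : {perm 'I_3} := tperm i0 i1; pose b : {perm 'I_3} := tperm i1 i2.
have aa : a * a = 1 by apply: tperm2.
have bb : b * b = 1 by apply: tperm2.
have ncab : ~ commute a b.
  move=> /(congr1 (fun s : {perm 'I_3} => s i0)).
  by rewrite !permM tpermL (tpermD (z := i0)) // tpermL tpermL.
have ab_braid : a ^ b = b ^ a.
  by rewrite !tpermJ !tpermL !tpermR !tpermD.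
have ab3 : (a * b) ^+ 3 = 1.
  rewrite !expgS mulg1.
  move: ab_braid; rewrite !conjgE (mulg1_eq aa) (mulg1_eq bb) => e.
  by rewrite -!mulgA e (mulgA a a) aa mul1g (mulgA b b) bb mul1g.
apply: (dihedral_finite_iso _ aa bb ab3 ncab) => //.
  exact: noncommuting_sq_neq1.
by rewrite card_Sn.
Qed.

(** * Quotients of the cactus group *)

Section CactusToInvolutions.
Variables (n : nat) (G : groupType) (a b : G).
Hypotheses (n3 : 2 < n) (aa : a * a = 1) (bb : b * b = 1).

(** Inside [1,n], the only interval of length n - 1 is [1,n], and those of
    length n - 2 are [1,n-1] and [2,n]. *)
Definition cactus_val (p q : nat) : G :=
  if q - p == n.-1 then b
  else if q - p == n.-2 then if p == 1%N then a else b * a * b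
  else 1.

Lemma cactus_val_short p q : q - p < n.-2 -> cactus_val p q = 1.
Proof. by move=> pq; rewrite /cactus_val !ifN //; lia. Qed.

Lemma cactus_val_full : cactus_val 1 n = b.
Proof. by rewrite /cactus_val ifT //; lia. Qed.

Lemma cactus_val_init : cactus_val 1 n.-1 = a.
Proof. by rewrite /cactus_val ifN ?ifT //; lia. Qed.

Lemma cactus_val_tail : cactus_val 2 n = b * a * b.
Proof. by rewrite /cactus_val ifN ?ifT //; lia. Qed.

Lemma cactus_val_sq p q : cactus_val p q * cactus_val p q = 1.
Proof.
rewrite /cactus_val; do 3?case: ifP => _; rewrite ?mulg1 //.
by rewrite -!mulgA (mulgA b b) bb mul1g (mulgA a a) aa mul1g.
Qed.

(** Two disjoint intervals in [1,n] cannot both have length at least n - 2,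
    as then 2 (n - 2) + 1 <= n - 1; this is where n >= 3 matters. *)
Lemma cactus_val_comm p q r s : 0 < p < q -> q < r < s -> s <= n ->
  commute (cactus_val p q) (cactus_val r s).
Proof.
move=> pq rs sn.
have [/cactus_val_short->|long] := ltnP (q - p) n.-2.
  exact/commute_sym/commute1.
by rewrite (@cactus_val_short r); [apply: commute1|lia].
Qed.

(** The flipped interval has the length of [r,s]. If that is at least n - 2,
    then either [r,s] = [p,q], or [p,q] = [1,n] and the flip exchanges [1,n-1]
    and [2,n]. *)
Lemma cactus_val_flip p q r s : 0 < p <= r -> r < s <= q -> q <= n ->
  cactus_val p q * cactus_val r s =
  cactus_val (p + q - s) (p + q - r) * cactus_val p q.
Proof.
move=> pr rs qn.
have [short|long] := ltnP (s - r) n.-2.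
  rewrite (@cactus_val_short r) // (@cactus_val_short (p + q - s)); last by lia.
  by rewrite mul1g mulg1.
have [[rp sq]|pq_full] : (r = p /\ s = q) \/ (p = 1%N /\ q = n) by lia.
  by rewrite rp sq addnK addKn.
rewrite !pq_full.1 !pq_full.2 cactus_val_full.
have [[-> ->]|[[-> ->]|[-> ->]]] :
  (r = 1%N /\ s = n) \/ (r = 1%N /\ s = n.-1) \/ (r = 2 /\ s = n) by lia.
- by rewrite addnK addKn cactus_val_full.
- have -> : 1 + n - n.-1 = 2 by lia.
  have -> : 1 + n - 1 = n by lia.
  by rewrite cactus_val_tail cactus_val_init -!mulgA bb mulg1.
- have -> : 1 + n - n = 1%N by lia.
  have -> : 1 + n - 2 = n.-1 by lia.
  by rewrite cactus_val_tail cactus_val_init !mulgA bb mul1g.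
Qed.

Lemma cactus_to_involutions : exists f : {multiplicative cactus n -> G},
  (exists x, f x = a) /\ (exists x, f x = b).
Proof.
pose phi (x : cactus_gen n) : G := cactus_val (val x).1 (val x).2.
have [u v|f fE] := @presented_lift _ (@cactus_rel n) G phi.
  case=> {u v} [x|x y dis|x y z sub zE];
    rewrite /word_val !(big_cons, big_nil) /= !mulg1.
  - exact: cactus_val_sq.
  - have := dis (val x).1; have := dis (val y).1; rewrite /nat_itv !inE /phi.
    case: x y {dis} => [[p q] /= pq] [[r s] /= rs] ry px.
    have [qr|sp] : q < r \/ s < p by lia.
      by apply: cactus_val_comm; lia.
    by apply/commute_sym/cactus_val_comm; lia.
  - have := sub (val y).1; have := sub (val y).2; rewrite /nat_itv !inE /phi zE.
    case: x y {sub zE} => [[p q] /= pq] [[r s] /= rs] sx rx.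
    by apply: cactus_val_flip; lia.
have g1 : (0 < 1) && (1 < n.-1 <= n) by lia.
have g2 : (0 < 1) && (1 < n <= n) by lia.
exists f; split.
  exists (pres_gen _ (exist _ (1%N, n.-1) g1)); rewrite fE.
  exact: cactus_val_init.
exists (pres_gen _ (exist _ (1%N, n) g2)); rewrite fE.
exact: cactus_val_full.
Qed.

End CactusToInvolutions.

Lemma cactus_onto_two_gen (n : nat) (R : word bool -> word bool -> Prop) :
  2 < n ->
  (forall t, pres_gen R t * pres_gen R t = 1) ->
  is_quotient (cactus n) (presented R).
Proof.
move=> n3 sq.
have [f [fa fb]] := cactus_to_involutions n3 (sq false) (sq true).
by apply: (@hom_onto_presented _ _ _ f); case.
Qed.

Lemma infinite_dihedral_gen_sq t :
  pres_gen infinite_dihedral_rel t * pres_gen infinite_dihedral_rel t = 1.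
Proof.
by rewrite /pres_gen -pi_cat; apply/presP/WordRel; case: t; constructor.
Qed.

Lemma nontrivial_of_hom (G H : groupType) (f : {multiplicative G -> H}) x :
  f x <> 1 -> nontrivial_group G.
Proof. by move=> fx; exists x => x1; apply: fx; rewrite x1 hom_one. Qed.

(** Sending both generators to one involution satisfies all the relations,
    whatever m is. *)
Lemma dihedral_nontrivial m : nontrivial_group (dihedral m).
Proof.
have sq : zdih_refl (m := 3) 0%R * zdih_refl 0%R = 1 := zdih_refl_sq _.
have [|f fE] := @dihedral_lift _ _ _ sq sq m; first by rewrite sq expg1n.
by apply: (@nontrivial_of_hom _ _ f (pres_gen _ false)); rewrite fE.
Qed.

Lemma infinite_dihedral_nontrivial : nontrivial_group infinite_dihedral.
Proof.
have sq : zdih_refl (m := 3) 0%R * zdih_refl 0%R = 1 := zdih_refl_sq _.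
have [f fE] := @infinite_dihedral_lift _ _ _ sq sq.
by apply: (@nontrivial_of_hom _ _ f (pres_gen _ false)); rewrite fE.
Qed.

Lemma abelian_quotient (G H : groupType) :
  is_quotient G H -> abelian_group G -> abelian_group H.
Proof.
move=> [f fs] Gab x y; have [u <-] := fs x; have [v <-] := fs y.
exact/gmulf_commute.
Qed.

Lemma dihedral_not_abelian m : 2 < m -> ~ abelian_group (dihedral m).
Proof.
move=> m3 /(abelian_quotient (group_iso_quotient (dihedral_zdih_iso m3))).
by move=> /(_ (zdih_refl 1%R) (zdih_refl 0%R)); apply: zdih_refl_not_commute.
Qed.

(** A group whose generators commute pairwise is abelian, so two of the
    images of the generators s_{p,q}, which are involutions, do not commute. *)
Lemma cactus_noncommuting_involutions n (Q : groupType) :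
  is_quotient (cactus n) Q -> ~ abelian_group Q ->
  exists a b : Q, [/\ a * a = 1, b * b = 1 & ~ commute a b].
Proof.
move=> [f fs] nab; apply: contrapT => none; apply: nab.
pose s x := f (pres_gen (@cactus_rel n) x).
have sq x : s x * s x = 1.
  rewrite -gmulfM /pres_gen -pi_cat -(hom_one f); congr (f _).
  exact/presP/WordRel/CactusInvol.
have sV x : (s x)^-1 = s x by apply: mulg1_eq.
have sC x y : commute (s x) (s y).
  by apply: contrapT => ns; apply: none; exists (s x), (s y).
have gC (g : Q) : (forall x, commute g (s x)) -> forall v, commute g (f v).
  move=> gs; elim/presented_ind => [|x y|x y].
    by rewrite hom_one; apply: commute1.
    by rewrite gmulfM => yC; apply: commuteM => //; apply: gs.
  rewrite gmulfM hom_inv [(f _)^-1]sV => yC.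
  by apply: commuteM => //; apply: gs.
move=> x y; have [u <-] := fs x; have [v <-] := fs y.
by apply: (gC) => z; apply/commute_sym/gC.
Qed.

(** * Orders of non-abelian quotients *)

Section Cardinality.
Local Open Scope classical_set_scope.
Local Open Scope card_scope.

Lemma card_range_inj (T : finType) (U : Type) (f : T -> U) :
  injective f -> range f #= `I_#|T|.
Proof.
move=> finj; have -> : range f = range (f \o @enum_val T T).
  apply/seteqP; split=> y [x _ <-]; last by exists (enum_val x).
  by exists (enum_rank x); rewrite //= enum_rankK.
rewrite (card_eq_trans (inj_card_eq _)) //; last exact: card_esym card_II.
by move=> i j _ _ /finj /enum_val_inj.
Qed.

Lemma inj_card_lower (T : finType) (U : Type) (f : T -> U) :
  injective f -> `I_#|T| #<= [set: U].
Proof.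
move=> /card_range_inj /card_eqPle[_ le]; apply: card_le_trans le _.
exact: subset_card_le.
Qed.

Lemma bij_card_eq (T : finType) (U : Type) (f : T -> U) :
  bijective f -> [set: U] #= `I_#|T|.
Proof.
move=> [g fK gK]; suff <- : range f = setT by apply/card_range_inj/(can_inj fK).
by apply/seteqP; split=> // y _; exists (g y).
Qed.

(** Beyond S_3 itself, a group with two non-commuting involutions contains
    8 normal forms, or a copy of D_3 and an element y outside it. *)
Lemma noncommuting_involutions_card (G : groupType) (a b : G) :
  a * a = 1 -> b * b = 1 -> ~ commute a b ->
  ~ group_iso G {perm 'I_3} -> `I_8 #<= [set: G].
Proof.
move=> aa bb ncab nS3; have rk := noncommuting_sq_neq1 aa bb ncab.
have [ab3|ab3] := pselect ((a * b) ^+ 3 = 1); last first.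
  have -> : 8 = #|{: 'I_4 * bool}| by rewrite card_prod card_ord card_bool.
  apply: (inj_card_lower (dih_elt_inj ncab _)) => k.
  by case: (eqVneq k 3) => [-> //|k3] /andP[k0 k4]; apply: rk; lia.
have [f fE] := dihedral_lift aa bb ab3.
have finj : injective f by apply: dihedral_hom_inj; rewrite ?fE.
pose g : 'I_3 * bool -> dihedral 3 :=
  @dih_elt _ (dgen 3 false) (dgen 3 true) 3.
have ginj : injective g.
  apply: (inj_compr (f := f)); apply: (eq_inj (dih_elt_inj ncab rk)) => p.
  by rewrite /= /g /dih_elt gmulfM !hom_exp gmulfM !fE.
have [y yf] : exists y, forall x, f x <> y.
  apply: contrapT => onto; apply: nS3.
  apply: group_iso_trans dihedral3_S3_iso; apply: group_iso_sym.
  exists f; rewrite -setTT_bijective; split=> // [x z _ _ /finj //|y _].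
  apply: contrapT => yf; apply: onto; exists y => x fx.
  by apply: yf; exists x.
(* The image of D_3 and its right translate by y are disjoint. *)
pose h (p : 'I_3 * bool * bool) := f (g p.1) * y ^+ p.2.
have hinj : injective h.
  move=> [p []] [q []]; rewrite /h /= ?expg1 ?mulg1.
  - by move=> /mulIg/finj/ginj->.
  - by move=> e; case: (yf ((g p)^-1 * g q)); rewrite gmulfM hom_inv -e mulKg.
  - by move=> e; case: (yf ((g q)^-1 * g p)); rewrite gmulfM hom_inv e mulKg.
  - by move=> /finj/ginj->.
apply: card_le_trans (inj_card_lower hinj).
by rewrite card_le_II !card_prod card_ord card_bool.
Qed.
End Cardinality.

End DihedralQuotients.

Local Open Scope classical_set_scope.
Local Open Scope card_scope.
Local Open Scope nat_scope.

Theorem theorem2 (n : nat) (hn : 3 <= n) :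
  [/\ forall m : nat, 1 <= m ->
        is_quotient (cactus n) (dihedral m) /\ nontrivial_group (dihedral m),
      is_quotient (cactus n) infinite_dihedral /\
        nontrivial_group infinite_dihedral,
      [/\ is_quotient (cactus n) {perm 'I_3} /\ ~ abelian_group {perm 'I_3},
          is_quotient (cactus n) (dihedral 4) /\ ~ abelian_group (dihedral 4),
          [set: dihedral 4] #= `I_8 &
          forall Q : groupType,
            is_quotient (cactus n) Q -> ~ abelian_group Q ->
            ~ group_iso Q {perm 'I_3} ->
            `I_8 #<= [set: Q]] &
      forall N : nat, exists Q : finGroupType,
        is_quotient (cactus n) Q /\ N < #|{: Q}|].
Proof.
have dihQ m : is_quotient (cactus n) (dihedral m).
  exact: cactus_onto_two_gen hn (dihedral_gen_sq m).
split.
- by move=> m _; split; [apply: dihQ|apply: dihedral_nontrivial].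
- split; last exact: infinite_dihedral_nontrivial.
  exact: cactus_onto_two_gen hn infinite_dihedral_gen_sq.
- have S3iso := dihedral3_S3_iso; split.
  + split; first exact: is_quotient_trans (dihQ 3) (group_iso_quotient S3iso).
    move/(abelian_quotient (group_iso_quotient (group_iso_sym S3iso))).
    exact: dihedral_not_abelian.
  + by split; [apply: dihQ|apply: dihedral_not_abelian].
  + have [f fbij] := group_iso_sym (@dihedral_zdih_iso 4 isT).
    by have := bij_card_eq fbij; rewrite card_zdih.
  + move=> Q cQ nab nS3.
    have [a [b [aa bb ncab]]] := cactus_noncommuting_involutions cQ nab.
    exact: noncommuting_involutions_card ncab nS3.
- move=> N; exists (zdih N.+3); split; last by rewrite card_zdih; lia.
  exact: is_quotient_trans (dihQ _) (group_iso_quotient (dihedral_zdih_iso _)).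
Qed.
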